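(* Let $T>0$, $\ell>0$. Let $a,f\in C([0,T]\times[-\ell,\ell]\times\mathbb{R}\times\mathbb{R})$ and $b(\cdot,\pm\ell,\cdot,\cdot),\,g(\cdot,\pm\ell,\cdot,\cdot)\in C([0,T]\times\mathbb{R}\times\mathbb{R})$ be real-valued with $a>0$ and $b(\cdot,\pm\ell,\cdot,\cdot)>0$. Let $u^0$ be Lipschitz continuous on $[-\ell,\ell]$, that is, $|u^0(x)-u^0(y)|\le K|x-y|$ for $x,y\in[-\ell,\ell]$. Let $M>0$ and suppose that there are $q_0\ge K$ and $\psi\in C^1([0,\infty),[1,\infty))$ with $$\int_{q_0}^\infty\frac{\rho\,d\rho}{\psi(\rho)}>2M$$ such that $$|f(t,x,z,p)|\le a(t,x,z,p)\,\psi(|p|),\qquad (t,x,z,p)\in\overline{\Omega}_T\times[-M,M]\times\mathbb{R},$$ and such that for all $(t,z)\in(0,T]\times[-M,M]$ and all $p\ge q_0$ $$g(t,\ell,z,p)\le b(t,\ell,z,p)p,\qquad -g(t,\ell,z,-p)\le b(t,\ell,z,-p)p,$$ $$-g(t,-\ell,z,p)\le b(t,-\ell,z,p)p,\qquad g(t,-\ell,z,-p)\le b(t,-\ell,z,-p)p.$$ Let $f_1$ (a real function of $(t,x,z,p)\in[0,T]\times[-\ell,\ell]\times\mathbb{R}\times\mathbb{R}$) and $g_1(\cdot,\pm\ell,\cdot,\cdot)$ (real functions of $(t,z,p)\in[0,T]\times\mathbb{R}\times\mathbb{R}$) satisfy, for all $t$, the following conditions: (i) $f_1(t,y,z_1,\pm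 p)-f_1(t,x,z_2,\pm p)\ge0$ (for both choices of sign) for $-\ell\le x\le y\le\ell$, $-M\le z_1\le z_2\le M$, $p\ge0$; (ii) $f_1(t,x,z_1,\pm p_1)-g_1(t,\ell,z_2,\pm p_2)\ge0$ (for both choices of sign) for $-\ell\le x\le\ell$, $-M\le z_1\le z_2\le M$, $q_0\le p_1\le p_2$; (iii) $g_1(t,\ell,z_1,-p_1)-f_1(t,x,z_2,-p_2)\ge0$ and $g_1(t,-\ell,z_1,p_1)-f_1(t,x,z_2,p_2)\ge0$ for $-\ell\le x\le\ell$, $-M\le z_1\le z_2\le M$, $q_0\le p_2\le p_1$. Then there exists a constant $M_1=M_1(q_0,M,\psi,K)$ such that the following holds: if $u$ is any classical solution on $\Omega_\tau$, with $\tau\le T$, to $$u_t-a(t,x,u,u_x)u_{xx}=f(t,x,u,u_x)+f_1(t,x,u,u_x),\qquad (t,x)\in(0,\tau)\times(-\ell,\ell),$$ $$u_t\pm b(t,x,u,u_x)u_x=g(t,x,u,u_x)+g_1(t,x,u,u_x),\qquad t\in(0,\tau),\ x=\pm\ell,$$ subject to $u(0,\cdot)=u^0$ on $[-\ell,\ell]$ and satisfying $|u|_{\Omega_\tau}\le M$, then $|u_x|_{\Omega_\tau}\le M_1$.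
   Context: $\Omega_\tau=(0,\tau)\times(-\ell,\ell)$ for $\tau>0$; $|v|_{\Omega_\tau}=\sup_{\Omega_\tau}|v|$. The boundary condition with $\pm$ means two conditions, with $+$ at $x=\ell$ and $-$ at $x=-\ell$. In (i) and (ii) the sign is the same in both terms. A classical solution on $\Omega_\tau$ is a function $u\in C^{1,2}(\Omega_\tau)\cap C(\overline{\Omega}_\tau)$ (that is, $u$ is continuous on $\overline{\Omega}_\tau$ and has continuous derivatives $u_t,u_{xx}$ on $\Omega_\tau$) whose derivatives $u_t(\cdot,\pm\ell)$ and $u_x(\cdot,\pm\ell)$ are defined on $(0,\tau)$ and which satisfies the equation and the boundary conditions pointwise.
   Formalization: In (i) with sign +, x and y are exchanged: f_1(t,x,z_1,p)-f_1(t,y,z_2,p)≥0 for x≤y; in (ii) with sign -, g_1 is taken at x=-ℓ instead of x=ℓ. With either condition as printed the claim is false: u_x can be unbounded as ℓ→0. *)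

(* Defs.v *)
From mathcomp Require Export all_boot all_order all_algebra.
From mathcomp Require Export all_classical all_reals all_analysis.
Set Implicit Arguments.
Unset Strict Implicit.
Unset Printing Implicit Defensive.
Export Order.TTheory GRing.Theory Num.Theory.
Export numFieldNormedType.Exports.
Local Open Scope classical_set_scope.
Local Open Scope ring_scope.

Definition Omega (R : realType) (tau ell : R) : set (R * R) :=
  `]0, tau[ `*` `]- ell, ell[.

Definition cOmega (R : realType) (tau ell : R) : set (R * R) :=
  `[0, tau] `*` `[- ell, ell].

(* The supremum is taken in the extended reals, so that it is [+oo] for an
   unbounded function. *)
Definition supnorm (R : realType) (D : set (R * R)) (v : R -> R -> R) : \bar R :=
  ereal_sup [set (`|v w.1 w.2|)%:E | w in D].

Definition ldiffquo (R : realType) (f : R -> R) (x : R) : set_system R :=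
  (f y - f x) / (y - x) @[y --> x^'-].
Definition rdiffquo (R : realType) (f : R -> R) (x : R) : set_system R :=
  (f y - f x) / (y - x) @[y --> x^'+].

Definition lderivable (R : realType) (f : R -> R) (x : R) : Prop :=
  cvg (ldiffquo f x).
Definition rderivable (R : realType) (f : R -> R) (x : R) : Prop :=
  cvg (rdiffquo f x).
Definition lderive (R : realType) (f : R -> R) (x : R) : R :=
  lim (ldiffquo f x).
Definition rderive (R : realType) (f : R -> R) (x : R) : R :=
  lim (rdiffquo f x).

(* Class C^1 on [0, +oo[, the derivative at 0 being one-sided; the values of
   [f] on the negative half-line are irrelevant. *)
Definition C1_nonneg (R : realType) (f : R -> R) : Prop :=
  exists df : R -> R,
    [/\ {within `[0, +oo[, continuous df},
        forall r : R, 0 < r -> is_derive r 1 f (df r),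
        rderivable f 0 & rderive f 0 = df 0].

Definition Dt (R : realType) (u : R -> R -> R) (t x : R) : R :=
  derive1 (fun s : R => u s x) t.
Definition Dx (R : realType) (u : R -> R -> R) (t x : R) : R :=
  derive1 (u t) x.
Definition Dxx (R : realType) (u : R -> R -> R) (t x : R) : R :=
  derive1 (Dx u t) x.

(* Only the values of [u] on [cOmega tau ell] matter.  The spatial derivatives
   at [ell] and [- ell] are the one-sided ones from inside the interval. *)
Record classical_regularity (R : realType) (tau ell : R) (u : R -> R -> R)
    : Prop := ClassicalRegularity {
  cr_cont : {within cOmega tau ell, continuous (fun w : R * R => u w.1 w.2)};
  cr_dt : forall t x : R, Omega tau ell (t, x) ->
    derivable (fun s : R => u s x) t 1;
  cr_dx : forall t x : R, Omega tau ell (t, x) -> derivable (u t) x 1;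
  cr_dxx : forall t x : R, Omega tau ell (t, x) -> derivable (Dx u t) x 1;
  cr_dt_cont :
    {within Omega tau ell, continuous (fun w : R * R => Dt u w.1 w.2)};
  cr_dxx_cont :
    {within Omega tau ell, continuous (fun w : R * R => Dxx u w.1 w.2)};
  cr_dt_right : forall t : R, 0 < t < tau ->
    derivable (fun s : R => u s ell) t 1;
  cr_dt_left : forall t : R, 0 < t < tau ->
    derivable (fun s : R => u s (- ell)) t 1;
  cr_dx_right : forall t : R, 0 < t < tau -> lderivable (u t) ell;
  cr_dx_left : forall t : R, 0 < t < tau -> rderivable (u t) (- ell) }.

(* Classical solution of
     u_t - a(t,x,u,u_x) u_xx = F(t,x,u,u_x)      for x in ]- ell, ell[,
     u_t +- b(t,x,u,u_x) u_x = G(t,x,u,u_x)      for x = +- ell.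
   Only the values of [b] and [G] at x = ell and x = - ell matter. *)
Record classical_solution (R : realType) (tau ell : R)
    (a b F G : R -> R -> R -> R -> R) (u : R -> R -> R)
    : Prop := ClassicalSolution {
  cs_regular : classical_regularity tau ell u;
  cs_interior : forall t x : R, Omega tau ell (t, x) ->
    Dt u t x - a t x (u t x) (Dx u t x) * Dxx u t x
      = F t x (u t x) (Dx u t x);
  cs_right : forall t : R, 0 < t < tau ->
    Dt u t ell
      + b t ell (u t ell) (lderive (u t) ell) * lderive (u t) ell
      = G t ell (u t ell) (lderive (u t) ell);
  cs_left : forall t : R, 0 < t < tau ->
    Dt u t (- ell)
      - b t (- ell) (u t (- ell)) (rderive (u t) (- ell))
        * rderive (u t) (- ell)
      = G t (- ell) (u t (- ell)) (rderive (u t) (- ell)) }.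

Definition continuous_4 (R : realType) (T ell : R)
    (a : R -> R -> R -> R -> R) : Prop :=
  {within [set w : R * R * R * R |
             0 <= w.1.1.1 <= T /\ - ell <= w.1.1.2 <= ell],
   continuous (fun w : R * R * R * R => a w.1.1.1 w.1.1.2 w.1.2 w.2)}.

Definition continuous_at_x (R : realType) (T x : R)
    (b : R -> R -> R -> R -> R) : Prop :=
  {within [set w : R * R * R | 0 <= w.1.1 <= T],
   continuous (fun w : R * R * R => b w.1.1 x w.1.2 w.2)}.

(* Main.v *)
Require Import Defs.
From mathcomp Require Import ring lra measurable_realfun.
Set Implicit Arguments.
Unset Strict Implicit.
Unset Printing Implicit Defensive.
Local Open Scope classical_set_scope.
Local Open Scope ring_scope.

(* Doubling of variables in the manner of Kruzhkov.  Choose q1 with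
   \int_q0^q1 rho / psi > 2 M, and let h solve h'' = - psi(h'), h(0) = 0,
   h'(0) = q1, up to the point s1 where h' = q0; then h(s1) > 2 M.  The function
   u(t,x) - u(t,y) - h(x - y) on 0 <= x - y <= s1 is nonpositive for t = 0
   (because q0 >= K), on x = y and on x - y = s1.  At a positive maximum the two
   first derivatives equal p = h'(x - y), the second ones contribute
   (a(x) + a(y)) h'', which absorbs f, and the monotonicity of f1, g1 takes care
   of the rest; at x = +- ell the one-sided slope is at least p >= q0, which is
   where the conditions on b and g apply.  The same argument for - u gives
   |u_x| <= h'(0) = q1, and q1 depends only on q0, M and psi. *)

(** * One-sided difference quotients and derivative tests at a maximum *)

Lemma is_derive_quotient (R : realType) (f : R -> R) (x l : R) :
  is_derive x 1 f l -> (f y - f x) / (y - x) @[y --> x^'] --> l.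
Proof.
move=> /is_derive1_caratheodory[g [fE cg gx]].
have {}cg : g y @[y --> x^'] --> l.
  by rewrite -gx; apply: (@cvg_within_filter _ _ _ (nbhs x)).
apply: cvg_trans cg; apply: near_eq_cvg; near=> y.
rewrite /= fE mulfK// subr_eq0.
by near: y; exact: nbhs_dnbhs_neq.
Unshelve. all: by end_near. Qed.

Lemma left_slope_at_max (R : realType) (f : R -> R) (x l : R) :
  (f y - f x) / (y - x) @[y --> x^'-] --> l ->
  (\forall y \near x^'-, f y <= f x) -> 0 <= l.
Proof.
move=> fl fx; apply: (cvgr_to_ge fl); near=> y.
have fyx : f y <= f x by near: y.
have yx : y <= x by near: y; exact: nbhs_left_le.
by rewrite -mulrNN -invrN mulr_ge0 ?invr_ge0 ?opprB ?subr_ge0.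
Unshelve. all: by end_near. Qed.

Lemma right_slope_at_max (R : realType) (f : R -> R) (x l : R) :
  (f y - f x) / (y - x) @[y --> x^'+] --> l ->
  (\forall y \near x^'+, f y <= f x) -> l <= 0.
Proof.
move=> fl fx; apply: (cvgr_to_le fl); near=> y.
have fyx : f y <= f x by near: y.
have yx : x <= y by near: y; exact: nbhs_right_ge.
by rewrite mulr_le0_ge0 ?invr_ge0 ?subr_le0 ?subr_ge0.
Unshelve. all: by end_near. Qed.

Lemma is_derive_left_quotient (R : realType) (f : R -> R) (x l : R) :
  is_derive x 1 f l -> (f y - f x) / (y - x) @[y --> x^'-] --> l.
Proof.
move=> /is_derive_quotient; apply: cvg_trans => A [e e0 eA].
by exists e => //= z zx; rewrite lt_neqAle => /andP[zNx _]; exact: eA.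
Qed.

Lemma is_derive_right_quotient (R : realType) (f : R -> R) (x l : R) :
  is_derive x 1 f l -> (f y - f x) / (y - x) @[y --> x^'+] --> l.
Proof.
move=> /is_derive_quotient; apply: cvg_trans => A [e e0 eA].
by exists e => //= z zx; rewrite lt_neqAle eq_sym => /andP[zNx _]; exact: eA.
Qed.

Lemma derive_at_local_max (R : realType) (f : R -> R) (x l : R) :
  is_derive x 1 f l -> (\forall y \near x, f y <= f x) -> l = 0.
Proof.
move=> dfx fx; apply/eqP; rewrite eq_le.
rewrite (right_slope_at_max (is_derive_right_quotient dfx)); last first.
  exact: cvg_within fx.
by apply: (left_slope_at_max (is_derive_left_quotient dfx)); exact: cvg_within fx.
Qed.

(** The first derivative vanishes at [x]. If [l] were positive, [df] would be positive just to the
    right of [x], and by the mean value theorem [f] would exceed [f x] there. *)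
Lemma second_derivative_at_local_max (R : realType) (f df : R -> R) (x l : R) :
  (\forall y \near x, is_derive (y : R) 1 f (df y)) -> is_derive x 1 df l ->
  (\forall y \near x, f y <= f x) -> l <= 0.
Proof.
move=> dfx ddf fx; rewrite leNgt; apply/negP => l0.
have dfx0 : df x = 0 := derive_at_local_max (nbhs_singleton dfx) fx.
have pos : \forall y \near x^'+, 0 < df y.
  near=> y; have : 0 < (df y - df x) / (y - x).
    near: y; apply: (cvgr_gt l _ _ l0).
    exact: is_derive_right_quotient.
  rewrite dfx0 subr0 pmulr_lgt0// invr_gt0 subr_gt0.
  by near: y; exact: nbhs_right_gt.
have [e e0 He] : exists2 e : R, 0 < e & forall y, x <= y < x + e ->
   is_derive (y : R) 1 f (df y) /\ f y <= f x /\ (x < y -> 0 < df y).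
  case: dfx => d1 /= d10 H1; case: fx => d2 /= d20 H2; case: pos => d3 /= d30 H3.
  exists (Num.min d1 (Num.min d2 d3)); first by rewrite !lt_min d10 d20.
  move=> y /andP[xy]; rewrite -ltrBlDl !lt_min => /and3P[y1 y2 y3].
  have E : `|x - y| = y - x by rewrite distrC ger0_norm// subr_ge0.
  split; first by apply: H1; rewrite /= E.
  split; first by apply: H2; rewrite /= E.
  by move=> xy'; apply: H3 => //; rewrite /= E.
have xe : x < x + e / 2 by rewrite ltrDl divr_gt0.
have e2 : e / 2 < e by rewrite ltr_pdivrMr// ltr_pMr// ltr1n.
have [||c] := @MVT _ f df _ _ xe.
- move=> y; rewrite in_itv/= => /andP[/ltW xy ye].
  by apply: (He y _).1; rewrite xy (lt_trans ye)// ltrD2l.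
- apply: derivable_within_continuous => y; rewrite in_itv/= => /andP[xy ye].
  by have [|[]] := He y; rewrite // xy (le_lt_trans ye)// ltrD2l.
rewrite in_itv/= => /andP[xc ce] fE.
have [|_ [_ /(_ xc) dfc]] := He c.
  by rewrite (ltW xc) (lt_trans ce)// ltrD2l.
have [|_ [fe _]] := He (x + e / 2); first by rewrite (ltW xe) ltrD2l.
suff : 0 < f (x + e / 2) - f x by rewrite subr_gt0 ltNge fe.
by rewrite fE mulr_gt0// subr_gt0.
Unshelve. all: by end_near. Qed.

(** * Continuity from one-sided derivatives *)

Lemma rderivable_cvg_at_right (R : realType) (f : R -> R) (x : R) :
  rderivable f x -> f y @[y --> x^'+] --> f x.
Proof.
move=> /cvg_ex[l fl].
have {}fl : (f y - f x) / (y - x) @[y --> x^'+] --> l by [].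
have id0 : (y - x) @[y --> x^'+] --> (0 : R).
  by rewrite -(subrr x); apply: cvgB; [exact/cvg_at_right_filter/cvg_id|exact: cvg_cst].
have fx : f x + (f y - f x) / (y - x) * (y - x) @[y --> x^'+] --> f x.
  rewrite -[X in _ --> X]addr0 -(mulr0 (l : R)).
  by apply: cvgD; [exact: cvg_cst|exact: cvgM].
apply: cvg_trans fx; apply: near_eq_cvg; near=> y.
have xy : x < y by near: y; exact: nbhs_right_gt.
by rewrite /= divfK ?subrKC// gt_eqF// subr_gt0.
Unshelve. all: by end_near. Qed.

Lemma lderivable_cvg_at_left (R : realType) (f : R -> R) (x : R) :
  lderivable f x -> f y @[y --> x^'-] --> f x.
Proof.
move=> /cvg_ex[l fl].
have {}fl : (f y - f x) / (y - x) @[y --> x^'-] --> l by [].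
have id0 : (y - x) @[y --> x^'-] --> (0 : R).
  by rewrite -(subrr x); apply: cvgB; [exact/cvg_at_left_filter/cvg_id|exact: cvg_cst].
have fx : f x + (f y - f x) / (y - x) * (y - x) @[y --> x^'-] --> f x.
  rewrite -[X in _ --> X]addr0 -(mulr0 (l : R)).
  by apply: cvgD; [exact: cvg_cst|exact: cvgM].
apply: cvg_trans fx; apply: near_eq_cvg; near=> y.
have xy : y < x by near: y; exact: nbhs_left_lt.
by rewrite /= divfK ?subrKC// lt_eqF// subr_lt0.
Unshelve. all: by end_near. Qed.

Lemma is_derive1_continuous (R : realType) (f : R -> R) (x l : R) :
  is_derive x 1 f l -> {for x, continuous f}.
Proof. by case=> /derivable1_diffP/differentiable_continuous. Qed.

Lemma C1_nonneg_continuous (R : realType) (f : R -> R) :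
  C1_nonneg f -> {within `[0, +oo[, continuous f}.
Proof.
case=> df [_ dfE rd _]; apply/continuous_within_itvcyP; split.
  by move=> x; rewrite in_itv/= andbT => x0; exact: is_derive1_continuous (dfE _ x0).
exact: rderivable_cvg_at_right.
Qed.

(** Extends a function by its value at 0 to the negative half-line, so that [psi] can be replaced by
    a function continuous on the whole line. *)
Lemma continuous_comp_max (R : realType) (f : R -> R) :
  {within `[0, +oo[, continuous f} -> continuous (fun x : R => f (Num.max 0 x)).
Proof.
move=> /subspace_continuousP cf x.
have m0 (y : R) : `[0, +oo[%classic (Num.max 0 y) by rewrite /= in_itv/= andbT le_max lexx.
apply: (@cvg_comp _ _ _ (fun y => Num.max 0 y) f _ (within `[0, +oo[ (nbhs (Num.max 0 x)))); last exact: cf.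
have cm : Num.max 0 y @[y --> x] --> Num.max 0 x.
  by apply: continuous_max; [exact: cvg_cst|exact: cvg_id].
move=> A /cm H.
have {}H : \forall y \near x, `[0, +oo[%classic (Num.max 0 y) -> A (Num.max 0 y) by [].
by apply: (filterS _ (H : nbhs x _)) => y; apply; exact: m0.
Qed.

(** * Integrals, antiderivatives and the barrier *)

(** Monotone convergence along the segments from [a] to [a + n]: if none of them had integral above
    [c], neither would the half-line. This yields the finite slope [q1]. *)
Lemma integral_itv_cbnd_lt (R : realType) (f : R -> R) (a c : R) :
  (forall x, a <= x -> 0 <= f x) -> {within `[a, +oo[, continuous f} ->
  (c%:E < \int[@lebesgue_measure R]_(x in `[a, +oo[) (f x)%:E)%E ->
  exists b : R, a <= b /\ (c%:E < \int[@lebesgue_measure R]_(x in `[a, b]) (f x)%:E)%E.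
Proof.
move=> f0 cf; rewrite itv_bndy_bigcup_BRight => cI; apply: contrapT => H.
move: cI; apply/negP; rewrite -leNgt.
have mf (b : R) : measurable_fun `[a, b] f.
  apply: subspace_continuous_measurable_fun => //; apply: continuous_subspaceW cf.
  by move=> x /=; rewrite !in_itv/= andbT => /andP[].
pose F (n : nat) : set R := `[a, a + n%:R]%classic.
have : (\int[@lebesgue_measure R]_(x in F n) (f x)%:E)%E @[n --> \oo] -->
    (\int[@lebesgue_measure R]_(x in \bigcup_n F n) (f x)%:E)%E.
  apply: ge0_nondecreasing_set_cvg_integral => //.
  - move=> m n mn; apply/subsetPset => x; rewrite /F /= !in_itv/= => /andP[-> xm] /=.
    by rewrite (le_trans xm)// lerD2l ler_nat.
  - by move=> i; exact: measurable_itv.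
  - by move=> i; apply/measurable_EFinP; exact: mf.
  - by move=> i x; rewrite /F /= in_itv/= lee_fin => /andP[/f0].
move=> cI; apply: (cvge_to_le cI).
near=> n => /=; rewrite leNgt; apply/negP => cn; apply: H.
by exists (a + n%:R); split => //; rewrite lerDl.
Unshelve. all: by end_near. Qed.

Lemma continuous_antiderivative (R : realType) (g : R -> R) (a b : R) :
  continuous g ->
  exists G : R -> R, forall x, a < x < b -> is_derive x 1 G (g x).
Proof.
move=> cg; exists (fun x => \int[@lebesgue_measure R]_(t in `[a, x]) g t) => x /andP[ax xb].
have [||||dG GE] := @continuous_FTC1_closed _ g a x b => //.
- apply: continuous_compact_integrable; first exact: segment_compact.
  exact: continuous_subspaceT.
- exact: cg.
by apply: DeriveDef => //; rewrite -derive1E.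
Qed.

Lemma is_derive_within_continuous (R : realType) (f df : R -> R) (a b : R) :
  (forall x, a <= x <= b -> is_derive x 1 f (df x)) -> {within `[a, b], continuous f}.
Proof.
by move=> dfE; apply: derivable_within_continuous => x; rewrite in_itv/= => /dfE[].
Qed.

Lemma is_derive_mean_value (R : realType) (f df : R -> R) (a b : R) :
  a <= b -> (forall x, a <= x <= b -> is_derive x 1 f (df x)) ->
  exists2 c, a <= c <= b & f b - f a = df c * (b - a).
Proof.
move=> ab dfE.
have [||c cab fE] := @MVT_segment _ f df _ _ ab.
- by move=> x; rewrite in_itv/= => /andP[/ltW ax /ltW xb]; apply: dfE; rewrite ax.
- exact: is_derive_within_continuous dfE.
by exists c => //; rewrite in_itv in cab.
Qed.

(* [S := \int d rho / phi] is inverted to solve [Q' = - phi Q], [Q 0 = q1];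
   then [h := \int_Q^q1 rho d rho / phi] satisfies [h' = Q]. *)
Lemma concave_barrier (R : realType) (phi : R -> R) (q0 q1 : R) :
  continuous phi -> (forall x, 0 < phi x) -> q0 < q1 ->
  exists (s1 : R) (h Q : R -> R), [/\ 0 < s1, h 0 = 0,
    (h s1)%:E = (\int[@lebesgue_measure R]_(x in `[q0, q1]) (x / phi x)%:E)%E &
    forall s, 0 <= s <= s1 ->
      [/\ q0 <= Q s <= q1, is_derive s 1 h (Q s) & is_derive s 1 Q (- phi (Q s))]].
Proof.
move=> cphi phi0 q01.
have phiV : continuous (fun x => (phi x)^-1).
  by move=> x; apply: cvgV; [rewrite gt_eqF//|exact: cphi].
have cg : continuous (fun x : R => x / phi x).
  by move=> x; apply: cvgM; [exact: cvg_id|exact: phiV].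
(* The interval is widened so that [q0] and [q1] are interior and all derivatives on the closed
   segment between them are two-sided. *)
pose a := q0 - 1; pose b := q1 + 1.
have aq x : q0 <= x <= q1 -> a < x < b by rewrite /a /b; lra.
have [S dS] := continuous_antiderivative a b phiV.
have [H dH] := continuous_antiderivative a b cg.
have Slt x y : a < x < b -> a < y < b -> x < y -> S x < S y.
  move=> /andP[ax xb] /andP[ay yb] xy.
  have [z /andP[xz zy]|c _ SE] := is_derive_mean_value (ltW xy) (f := S) (df := fun x => (phi x)^-1).
    by apply: dS; rewrite (lt_le_trans ax xz) (le_lt_trans zy yb).
  by rewrite -subr_gt0 SE mulr_gt0 ?subr_gt0// invr_gt0.
pose s q := S q1 - S q.
(* [Q] is the inverse of [s]; strict monotonicity of [S] makes the chosen point unique. *)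
pose Q t := xget q1 [set q | a < q < b /\ s q = t].
have sK q : a < q < b -> Q (s q) = q.
  move=> qab; rewrite /Q; case: xgetP => [x _ [xab /addrI/oppr_inj SE]|/(_ q)[]//].
  by have [/(Slt _ _ xab qab)|/(Slt _ _ qab xab)|//] := ltgtP x q; rewrite SE ltxx.
have ab_near q : a < q < b -> \forall x \near q, a < x < b.
  move=> /andP[aq1 qb]; near=> x; apply/andP; split; near: x.
    exact: lt_nbhsr.
  exact: lt_nbhsl.
have ds q : a < q < b -> is_derive q 1 s (- (phi q)^-1).
  by move=> /dS dSq; rewrite -[X in is_derive _ _ _ X]sub0r; exact: is_deriveB.
have dQ q : a < q < b -> is_derive (s q) 1 Q (- phi q).
  move=> qab; rewrite -[phi q]invrK -invrN; apply: is_derive_inverse.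
  - by apply: filterS (ab_near _ qab) => x; exact: sK.
  - by apply: filterS (ab_near _ qab) => x /ds; exact: is_derive1_continuous.
  - exact: ds.
  - by rewrite oppr_eq0 invr_eq0 gt_eqF.
have q0ab : a < q0 < b by apply: aq; lra.
have q1ab : a < q1 < b by apply: aq; lra.
(* By the intermediate value theorem every parameter in the domain of the barrier is [s q] for a
   slope [q] between [q0] and [q1], so all its properties can be checked at points [s q]. *)
have s_onto t : 0 <= t <= s q0 -> exists2 q, q0 <= q <= q1 & s q = t.
  move=> /andP[t0 ts].
  have [||c] := @IVT _ s q0 q1 t (ltW q01).
  - by apply: (is_derive_within_continuous (df := fun q => - (phi q)^-1)) => q /aq; exact: ds.
  - by rewrite /s subrr ge_min le_max t0 ts !orbT.
  - by rewrite in_itv/= => ? ?; exists c.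
exists (s q0), (fun t => H q1 - H (Q t)), Q; split.
- by rewrite subr_gt0 Slt.
- by rewrite -[X in Q X](subrr (S q1)) sK// subrr.
- rewrite sK// (continuous_FTC2 q01 (F := H)) ?EFinB//.
  + exact: continuous_subspaceT.
  + split; last 2 first.
    * exact/cvg_at_right_filter/(is_derive1_continuous (dH _ q0ab)).
    * exact/cvg_at_left_filter/(is_derive1_continuous (dH _ q1ab)).
    move=> x; rewrite in_itv/= => /andP[/ltW q0x /ltW xq1].
    by have [] := dH x _ => //; apply: aq; rewrite q0x.
  + move=> x; rewrite in_itv/= => /andP[/ltW q0x /ltW xq1].
    by rewrite derive1E; have [] := dH x _ => //; apply: aq; rewrite q0x.
- move=> t /s_onto[q qq <-]; have qab := aq _ qq.
  rewrite sK//; split=> //; last exact: dQ.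
  (* The factors [phi] cancel: [H' = q / phi q] and [Q' = - phi q] give [(H \o Q)' = - q], whence
     [h' = Q]. *)
  have dHQ : is_derive (s q) 1 (H \o Q) (q / phi q * - phi q).
    by apply: is_derive1_comp; [rewrite sK//; exact: dH|exact: dQ].
  rewrite mulrN divfK ?gt_eqF// in dHQ.
  by rewrite -[X in is_derive _ _ _ X]opprK -[X in is_derive _ _ _ X]sub0r; exact: is_deriveB.
Unshelve. all: by end_near. Qed.

(** * Comparison of derivatives at a point of contact *)

Lemma derivable_is_derive1 (R : realType) (f : R -> R) (x : R) :
  derivable f x 1 -> is_derive x 1 f (derive1 f x).
Proof. by move=> df; apply: DeriveDef => //; rewrite derive1E. Qed.

Lemma is_derive_shiftl (R : realType) (f : R -> R) (c x l : R) :
  is_derive (x - c) 1 f l -> is_derive x 1 (fun z => f (z - c)) l.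
Proof.
move=> df; rewrite -[l]mulr1.
apply: (@is_derive1_comp _ f (fun z => z - c)) => //.
by rewrite -[X in is_derive _ _ _ X]subr0; exact: is_deriveB.
Qed.

Lemma is_derive_reflect (R : realType) (f : R -> R) (c x l : R) :
  is_derive (c - x) 1 f l -> is_derive x 1 (fun z => f (c - z)) (- l).
Proof.
move=> df; rewrite -[l]mulr1 -mulrN.
apply: (@is_derive1_comp _ f (fun z => c - z)) => //.
by rewrite -[X in is_derive _ _ _ X]sub0r; exact: is_deriveB.
Qed.

(** The first and second order conditions at a maximum of [e * v - k]. The factor [e] lets one lemma
    serve [u] and [- u], and also both variables of the doubled function, where [u] enters with
    opposite signs. *)
Lemma touching_derivatives (R : realType) (v k dk : R -> R) (e x l : R) :
  (\forall z \near x, derivable v z 1) -> derivable (derive1 v) x 1 ->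
  (\forall z \near x, is_derive (z : R) 1 k (dk z)) -> is_derive x 1 dk l ->
  (\forall z \near x, e * v z - k z <= e * v x - k x) ->
  e * derive1 v x = dk x /\ e * derive1 (derive1 v) x <= l.
Proof.
move=> dv ddv dkE ddk vmax.
have dw : \forall z \near x,
    is_derive (z : R) 1 (fun z => e * v z - k z) (e * derive1 v z - dk z).
  near=> z; apply: is_deriveB; last by near: z.
  by apply: is_deriveZ; apply: derivable_is_derive1; near: z.
split.
  by apply/eqP; rewrite -subr_eq0; apply/eqP; exact: derive_at_local_max (nbhs_singleton dw) vmax.
rewrite -subr_le0; apply: second_derivative_at_local_max dw _ vmax.
by apply: is_deriveB => //; apply: is_deriveZ; exact: derivable_is_derive1.
Unshelve. all: by end_near. Qed.

Lemma quotient_combination (R : realType) (F : set_system R) (FF : ProperFilter F)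
    (v k : R -> R) (e x l m : R) :
  (v y - v x) / (y - x) @[y --> F] --> l ->
  (k y - k x) / (y - x) @[y --> F] --> m ->
  (e * v y - k y - (e * v x - k x)) / (y - x) @[y --> F] --> e * l - m.
Proof.
move=> vl km.
have vk : e * ((v y - v x) / (y - x)) - (k y - k x) / (y - x) @[y --> F] --> e * l - m.
  by apply: cvgB => //; apply: cvgM => //; exact: cvg_cst.
apply: cvg_trans vk; apply: near_eq_cvg; near=> y.
by rewrite mulrA -mulrBl; congr (_ / _); ring.
Unshelve. all: by end_near. Qed.

(** At an endpoint a maximum gives only an inequality between slopes. Its direction is the useful
    one: the boundary slope is at least that of the barrier, hence at least [q0]. *)
Lemma touching_lderive (R : realType) (v k : R -> R) (e x l : R) :
  lderivable v x -> is_derive x 1 k l ->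
  (\forall z \near x^'-, e * v z - k z <= e * v x - k x) ->
  l <= e * lderive v x.
Proof.
move=> dv dk vmax; rewrite -subr_ge0.
apply: (@left_slope_at_max _ (fun z => e * v z - k z) x) => //.
by apply: quotient_combination => //; exact: is_derive_left_quotient.
Qed.

Lemma touching_rderive (R : realType) (v k : R -> R) (e x l : R) :
  rderivable v x -> is_derive x 1 k l ->
  (\forall z \near x^'+, e * v z - k z <= e * v x - k x) ->
  e * rderive v x <= l.
Proof.
move=> dv dk vmax; rewrite -subr_le0.
apply: (@right_slope_at_max _ (fun z => e * v z - k z) x) => //.
by apply: quotient_combination => //; exact: is_derive_right_quotient.
Qed.

(** * Maximum principle for the doubled function *)

(* Points of [strip] are encoded as [((t, x), y)]. *)
Definition strip (R : realType) (tau ell s1 : R) : set (R * R * R) :=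
  [set w : R * R * R | [/\ 0 <= w.1.1 <= tau, - ell <= w.2,
     w.1.2 <= ell & 0 <= w.1.2 - w.2 <= s1]].

Lemma compact_strip (R : realType) (tau ell s1 : R) : compact (strip tau ell s1).
Proof.
apply: (@subclosed_compact _ _ (`[0, tau] `*` `[- ell, ell] `*` `[- ell, ell])).
- have closed_le (g k : R * R * R -> R) : continuous g -> continuous k ->
      closed [set w | g w <= k w].
    move=> cg ck; rewrite [X in closed X](_ : _ = (k \- g) @^-1` [set r | 0 <= r]).
      apply: closed_comp => [w _|]; last exact: closed_ge.
      by apply: cvgB; [exact: ck|exact: cg].
    by apply/seteqP; split => w /=; rewrite subr_ge0.
  have ct : continuous (fun w : R * R * R => w.1.1).
    by move=> w; apply: (@cvg_comp _ _ _ fst fst _ (nbhs w.1)); exact: cvg_fst.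
  have cx : continuous (fun w : R * R * R => w.1.2).
    by move=> w; apply: (@cvg_comp _ _ _ fst snd _ (nbhs w.1)); [exact: cvg_fst|exact: cvg_snd].
  have cy : continuous (fun w : R * R * R => w.2) by move=> w; exact: cvg_snd.
  have cc (c : R) : continuous (fun _ : R * R * R => c) by move=> w; exact: cvg_cst.
  have cxy : continuous (fun w : R * R * R => w.1.2 - w.2).
    by move=> w; apply: cvgB; [exact: cx|exact: cy].
  rewrite [X in closed X](_ : strip tau ell s1 =
    [set w | 0 <= w.1.1] `&` [set w | w.1.1 <= tau] `&` [set w | - ell <= w.2] `&`
    [set w | w.1.2 <= ell] `&` [set w | 0 <= w.1.2 - w.2] `&` [set w | w.1.2 - w.2 <= s1]).
    by do !apply: closedI; apply: closed_le.
  apply/seteqP; split => w /=; first by case=> /andP[? ?] ? ? /andP[].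
  by move=> [[[[[? ?] ?] ?] ?] ?]; split => //; apply/andP.
- apply: compact_setX; last exact: segment_compact.
  by apply: compact_setX; exact: segment_compact.
- move=> [[t x] y]; rewrite /strip /= => -[? ? ? /andP[? ?]]; rewrite !in_itv/=; split; last lra.
  by split=> //; lra.
Qed.

(** Transports relative continuity along a map from [A] to [B]; it pulls the continuity of [u] on
    the closed rectangle back to the strip along [(t, x, y) -> (t, x)] and [(t, x, y) -> (t, y)]. *)
Lemma cvg_comp_within (T U V : topologicalType) (A : set T) (B : set U)
    (g : T -> U) (f : U -> V) (w : T) (l : V) :
  g z @[z --> w] --> g w -> (forall z, A z -> B (g z)) -> A w ->
  (B (g w) -> f z @[z --> within B (nbhs (g w))] --> l) ->
  f (g z) @[z --> within A (nbhs w)] --> l.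
Proof.
move=> cg AB Aw /(_ (AB _ Aw)).
apply: (@cvg_comp _ _ _ g f) => D /cg HD.
have {}HD : \forall z \near w, B (g z) -> D (g z) by [].
by apply: (filterS _ (HD : nbhs w _)) => z Hz /AB; exact: Hz.
Qed.

Lemma doubled_continuous (R : realType) (tau t1 ell s1 e eta : R)
    (u : R -> R -> R) (h : R -> R) :
  {within cOmega tau ell, continuous (fun w : R * R => u w.1 w.2)} ->
  (forall s, 0 <= s <= s1 -> {for s, continuous h}) -> t1 <= tau ->
  {within strip t1 ell s1, continuous (fun w : R * R * R =>
     e * (u w.1.1 w.1.2 - u w.1.1 w.2) - h (w.1.2 - w.2) - eta * w.1.1)}.
Proof.
move=> /subspace_continuousP cu ch t1tau; apply/subspace_continuousP => w Cw.
have ct : (fun w : R * R * R => w.1.1) @ nbhs w --> w.1.1.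
  by apply: (@cvg_comp _ _ _ fst fst _ (nbhs w.1)); exact: cvg_fst.
have cx : (fun w : R * R * R => w.1.2) @ nbhs w --> w.1.2.
  by apply: (@cvg_comp _ _ _ fst snd _ (nbhs w.1)); [exact: cvg_fst|exact: cvg_snd].
have cy : (fun w : R * R * R => w.2) @ nbhs w --> w.2 by exact: cvg_snd.
have cux : (fun w : R * R * R => u w.1.1 w.1.2) @ within (strip t1 ell s1) (nbhs w)
    --> u w.1.1 w.1.2.
  apply: (cvg_comp_within (g := fun z => (z.1.1, z.1.2)) (f := fun z => u z.1 z.2)
    (cvg_pair ct cx) _ Cw (cu (_, _))).
  by move=> z [? ? ? ?]; rewrite /cOmega /= !in_itv/=; split; lra.
have cuy : (fun w : R * R * R => u w.1.1 w.2) @ within (strip t1 ell s1) (nbhs w)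
    --> u w.1.1 w.2.
  apply: (cvg_comp_within (g := fun z => (z.1.1, z.2)) (f := fun z => u z.1 z.2)
    (cvg_pair ct cy) _ Cw (cu (_, _))).
  by move=> z [? ? ? ?]; rewrite /cOmega /= !in_itv/=; split; lra.
have chw : (fun w : R * R * R => h (w.1.2 - w.2)) @ nbhs w --> h (w.1.2 - w.2).
  have := ch (w.1.2 - w.2); case: Cw => _ _ _ sw /(_ sw).
  by apply: (@cvg_comp _ _ _ (fun z : R * R * R => z.1.2 - z.2)); exact: cvgB cx cy.
apply: cvgB; first apply: cvgB.
- by apply: cvgM; [exact: cvg_cst|exact: cvgB].
- exact: cvg_within_filter chw.
- by apply: cvg_within_filter; apply: cvgM => //; exact: cvg_cst.
Qed.

(* At a positive maximum of [e (u t x - u t y) - h (x - y) - eta t], with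
   [p = Q (x - y)], the hypotheses on [F] chain up to
   [e u_t(t, x) <= F t x p <= F t y p <= e u_t(t, y)], against
   [e (u_t(t, x) - u_t(t, y)) >= eta > 0]. *)
Lemma doubled_barrier (R : realType) (tau ell s1 e : R) (u : R -> R -> R)
    (h Q phi : R -> R) (F : R -> R -> R -> R) :
  classical_regularity tau ell u ->
  (forall s, 0 <= s <= s1 ->
     is_derive s 1 h (Q s) /\ is_derive s 1 Q (- phi (Q s))) ->
  (forall s, 0 <= s <= s1 -> 0 <= h s) ->
  (forall x y, - ell <= y -> x <= ell -> 0 <= x - y <= s1 ->
     e * (u 0 x - u 0 y) <= h (x - y)) ->
  (forall t x y, 0 < t < tau -> - ell <= y -> x <= ell -> x - y = s1 ->
     e * (u t x - u t y) <= h s1) ->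
  (forall t x s, 0 < t < tau -> - ell < x < ell -> 0 < s < s1 ->
     e * Dx u t x = Q s -> e * Dxx u t x <= - phi (Q s) ->
     e * Dt u t x <= F t x (Q s)) ->
  (forall t s, 0 < t < tau -> 0 < s < s1 -> Q s <= e * lderive (u t) ell ->
     e * Dt u t ell <= F t ell (Q s)) ->
  (forall t y s, 0 < t < tau -> - ell < y < ell -> 0 < s < s1 ->
     e * Dx u t y = Q s -> phi (Q s) <= e * Dxx u t y ->
     F t y (Q s) <= e * Dt u t y) ->
  (forall t s, 0 < t < tau -> 0 < s < s1 -> Q s <= e * rderive (u t) (- ell) ->
     F t (- ell) (Q s) <= e * Dt u t (- ell)) ->
  (forall t x y s, 0 < t < tau -> - ell <= y -> y < x -> x <= ell -> 0 < s < s1 ->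
     e * u t y < e * u t x -> F t x (Q s) <= F t y (Q s)) ->
  forall t x y, 0 < t < tau -> - ell <= y -> x <= ell -> 0 <= x - y <= s1 ->
    h 0 = 0 -> e * (u t x - u t y) <= h (x - y).
Proof.
move=> ru dhQ h_ge0 init top upx upl lowy lowl mono t1 x1 y1 /andP[t1_gt0 t1tau] y1l x1l s1E h00.
rewrite leNgt; apply/negP => W1.
(* [eta * t1] is half of the supposed excess at [(t1, x1, y1)], so the penalised function is still
   positive there. *)
pose eta := (e * (u t1 x1 - u t1 y1) - h (x1 - y1)) / (2 * t1).
have eta0 : 0 < eta by rewrite divr_gt0 ?subr_gt0// mulr_gt0.
pose W (w : R * R * R) := e * (u w.1.1 w.1.2 - u w.1.1 w.2) - h (w.1.2 - w.2) - eta * w.1.1.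
(* Time is cut off at [t1 < tau]: the maximum may sit at the final time [t1], where the equation and
   the boundary conditions still hold. *)
have [|||[[t0 x0] y0]] := @compact_EVT_max _ _ W (strip t1 ell s1).
- by exists (t1, x1, y1); split => //=; rewrite lexx ltW.
- exact: compact_strip.
- apply: doubled_continuous (cr_cont ru) _ (ltW t1tau).
  by move=> s /dhQ[/is_derive1_continuous].
rewrite inE => -[/= /andP[t0_ge0 t0t1] y0l x0l sE0] Wmax.
have {}Wmax t x y : 0 <= t <= t1 -> - ell <= y -> x <= ell -> 0 <= x - y <= s1 ->
    W (t, x, y) <= W (t0, x0, y0).
  by move=> *; apply: Wmax; rewrite inE.
have W0 : 0 < e * (u t0 x0 - u t0 y0) - h (x0 - y0) - eta * t0.
  have : W (t1, x1, y1) <= W (t0, x0, y0) by apply: Wmax => //; rewrite lexx ltW.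
  apply: lt_le_trans; rewrite /W/=.
  have -> : eta * t1 = (e * (u t1 x1 - u t1 y1) - h (x1 - y1)) / 2.
    by rewrite /eta; field; exact: lt0r_neq0.
  by move: W1; lra.
have W00 : h (x0 - y0) < e * (u t0 x0 - u t0 y0).
  by rewrite -subr_gt0 (lt_le_trans W0)// gerBl mulr_ge0// ltW.
have t0_gt0 : 0 < t0.
  rewrite lt_neqAle t0_ge0 andbT; apply/eqP => t00.
  by move: W00; rewrite -t00 ltNge init.
have t0tau : 0 < t0 < tau by rewrite t0_gt0 (le_lt_trans t0t1).
(* The diagonal is excluded by [h 0 = 0], the edge [x - y = s1] by [top]. *)
have [yx0 x0s1] : y0 < x0 /\ x0 - y0 < s1.
  move: sE0 => /andP[]; rewrite subr_ge0 !le_eqVlt => /predU1P[yx _|yx /predU1P[sE|//]].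
    by exfalso; move: W00; rewrite yx !subrr h00 mulr0 ltxx.
  by exfalso; move: W00; rewrite sE ltNge top.
have s0 : 0 < x0 - y0 < s1 by rewrite subr_gt0 yx0.
have x0gt : - ell < x0 by exact: le_lt_trans yx0.
have y0lt : y0 < ell by exact: lt_le_trans yx0 x0l.
have dhs s : 0 <= s <= s1 -> is_derive s 1 h (Q s) by move=> /dhQ[].
have dQs s : 0 <= s <= s1 -> is_derive s 1 Q (- phi (Q s)) by move=> /dhQ[].
have maxx x : x <= ell -> 0 <= x - y0 <= s1 ->
    e * u t0 x - h (x - y0) <= e * u t0 x0 - h (x0 - y0).
  move=> xl xs; have := Wmax t0 x y0; rewrite t0_ge0 t0t1 => /(_ isT y0l xl xs).
  by rewrite /W/=; lra.
have maxy y : - ell <= y -> 0 <= x0 - y <= s1 ->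
    (- e) * u t0 y - h (x0 - y) <= (- e) * u t0 y0 - h (x0 - y0).
  move=> yl ys; have := Wmax t0 x0 y; rewrite t0_ge0 t0t1 => /(_ isT yl x0l ys).
  by rewrite /W/=; lra.
have dtx : is_derive t0 1 (u^~ x0) (Dt u t0 x0).
  apply: derivable_is_derive1.
  move: x0l; rewrite le_eqVlt => /predU1P[->|x0l]; first exact: cr_dt_right ru _ t0tau.
  by apply: (cr_dt ru); rewrite /Omega /= !in_itv/= t0tau x0gt.
have dty : is_derive t0 1 (u^~ y0) (Dt u t0 y0).
  apply: derivable_is_derive1.
  move: y0l; rewrite le_eqVlt => /predU1P[<-|y0l]; first exact: cr_dt_left ru _ t0tau.
  by apply: (cr_dt ru); rewrite /Omega /= !in_itv/= t0tau y0l.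
(* Only earlier times are compared, since [t0] may equal [t1]; the left slope in time at the maximum
   is nonnegative. *)
have timeineq : 0 <= e * (Dt u t0 x0 - Dt u t0 y0) - eta.
  have dg : is_derive t0 1 (fun t => e * (u t x0 - u t y0) - eta * t)
      (e * (Dt u t0 x0 - Dt u t0 y0) - eta * 1).
    by apply: is_deriveB; apply: is_deriveZ; exact: is_deriveB.
  rewrite -[X in _ - X]mulr1; apply: left_slope_at_max (is_derive_left_quotient dg) _.
  near=> t.
  have tt0 : t <= t0 by near: t; exact: nbhs_left_le.
  have t_gt0 : 0 < t by near: t; exact: nbhs_left_gt.
  have := Wmax t x0 y0; rewrite (ltW t_gt0) (le_trans tt0 t0t1) => /(_ isT y0l x0l sE0).
  by rewrite /W/=; lra.
have nearx : \forall x \near x0, 0 < x - y0 < s1.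
  near=> x; rewrite subr_gt0 ltrBlDr; apply/andP; split; near: x.
    exact: lt_nbhsr.
  by apply: lt_nbhsl; rewrite -ltrBlDr.
have neary : \forall y \near y0, 0 < x0 - y < s1.
  near=> y; rewrite subr_gt0 ltrBlDr -ltrBlDl; apply/andP; split; near: y.
    exact: lt_nbhsl.
  by apply: lt_nbhsr; rewrite ltrBlDl -ltrBlDr.
have upper : e * Dt u t0 x0 <= F t0 x0 (Q (x0 - y0)).
  move: x0l; rewrite le_eqVlt => /predU1P[x0l|x0l].
    rewrite x0l; apply: upl => //; first by rewrite -x0l.
    apply: (@touching_lderive _ _ (fun z => h (z - y0))); first exact: cr_dx_right ru _ t0tau.
      by apply: is_derive_shiftl; apply: dhs; rewrite -x0l.
    near=> z; rewrite -x0l; apply: maxx.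
      by rewrite -x0l; near: z; rewrite -x0l; exact: nbhs_left_le.
    have /andP[/ltW -> /ltW ->]// : 0 < z - y0 < s1.
    by near: z; rewrite -x0l; exact: cvg_within nearx.
  have [] := @touching_derivatives _ (u t0) (fun z => h (z - y0)) (fun z => Q (z - y0))
     e x0 (- phi (Q (x0 - y0))).
  - near=> z; apply: (cr_dx ru); rewrite /Omega /= !in_itv/= t0tau; split=> //.
    by apply/andP; split; near: z; [exact: lt_nbhsr|exact: lt_nbhsl].
  - by apply: (cr_dxx ru); rewrite /Omega /= !in_itv/= t0tau x0gt.
  - near=> z; apply: is_derive_shiftl; apply: dhs.
    have /andP[/ltW -> /ltW ->]// : 0 < z - y0 < s1 by near: z.
  - by apply: is_derive_shiftl; apply: dQs.
  - near=> z; apply: maxx; first by apply/ltW; near: z; exact: lt_nbhsl.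
    have /andP[/ltW -> /ltW ->]// : 0 < z - y0 < s1 by near: z.
  by move=> d1 d2; apply: upx => //; rewrite x0gt.
(* In [y] the contact is for [- e * u] with [h (x0 - y)]. Reflection changes the sign of the first
   derivative of the barrier but not of the second, which remains [- phi]. *)
have lower : F t0 y0 (Q (x0 - y0)) <= e * Dt u t0 y0.
  move: y0l; rewrite le_eqVlt => /predU1P[y0l|y0l].
    rewrite -y0l; apply: lowl => //; first by rewrite y0l.
    rewrite -lerN2 -mulNr.
    apply: (@touching_rderive _ _ (fun z => h (x0 - z))); first exact: cr_dx_left ru _ t0tau.
      by apply: is_derive_reflect; apply: dhs; rewrite y0l.
    near=> z; rewrite y0l; apply: maxy.
      by rewrite y0l; near: z; rewrite y0l; exact: nbhs_right_ge.
    have /andP[/ltW -> /ltW ->]// : 0 < x0 - z < s1.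
    by near: z; rewrite y0l; exact: cvg_within neary.
  have [] := @touching_derivatives _ (u t0) (fun z => h (x0 - z)) (fun z => - Q (x0 - z))
     (- e) y0 (- phi (Q (x0 - y0))).
  - near=> z; apply: (cr_dx ru); rewrite /Omega /= !in_itv/= t0tau; split=> //.
    by apply/andP; split; near: z; [exact: lt_nbhsr|exact: lt_nbhsl].
  - by apply: (cr_dxx ru); rewrite /Omega /= !in_itv/= t0tau y0l.
  - near=> z; apply: is_derive_reflect; apply: dhs.
    have /andP[/ltW -> /ltW ->]// : 0 < x0 - z < s1 by near: z.
  - rewrite -[X in is_derive _ _ _ X]opprK; apply: is_deriveN.
    by apply: is_derive_reflect; apply: dQs.
  - near=> z; apply: maxy; first by apply/ltW; near: z; exact: lt_nbhsr.
    have /andP[/ltW -> /ltW ->]// : 0 < x0 - z < s1 by near: z.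
  rewrite !mulNr => /oppr_inj d1; rewrite lerN2 => d2.
  by apply: lowy => //; rewrite y0l.
(* Since [h] is nonnegative, the positive maximum also orders the values of [e * u], as the
   monotonicity in [z] requires. *)
have eu : e * u t0 y0 < e * u t0 x0.
  by rewrite -subr_gt0 -mulrBr (le_lt_trans _ W00)// h_ge0.
have := mono t0 x0 y0 _ t0tau y0l yx0 x0l s0 eu.
by move: upper lower timeineq eta0; rewrite mulrBr; lra.
Unshelve. all: by end_near. Qed.

(** * The gradient estimate *)

Lemma supnorm_le (R : realType) (D : set (R * R)) (v : R -> R -> R) (M : R) :
  (supnorm D v <= M%:E)%E <-> forall t x, D (t, x) -> `|v t x| <= M.
Proof.
split=> [vM t x tx|vM].
  rewrite -lee_fin (le_trans _ vM)//; apply: ereal_sup_ubound.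
  by exists (t, x).
by apply: ge_ereal_sup => _ [[t x] tx <-]; rewrite lee_fin vM.
Qed.

(** The one-sided derivatives at the endpoints force one-sided continuity in [x], so the interior
    bound passes to the limit. *)
Lemma classical_regularity_bound (R : realType) (tau ell M : R) (u : R -> R -> R) :
  classical_regularity tau ell u -> - ell < ell ->
  (forall t x, Omega tau ell (t, x) -> `|u t x| <= M) ->
  forall t x, 0 < t < tau -> - ell <= x <= ell -> `|u t x| <= M.
Proof.
move=> ru ell0 uM t x tt /andP[].
have uM' y : - ell < y -> y < ell -> `|u t y| <= M.
  by move=> ly yl; apply: uM; rewrite /Omega /= !in_itv/= tt ly.
rewrite le_eqVlt => /predU1P[<- _|lx]; last rewrite le_eqVlt => /predU1P[->|xl].
- have /cvg_norm cu := rderivable_cvg_at_right (cr_dx_left ru tt).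
  apply: (cvgr_to_le cu); near=> y.
  by apply: uM'; near: y; [exact: nbhs_right_gt|exact: nbhs_right_lt].
- have /cvg_norm cu := lderivable_cvg_at_left (cr_dx_right ru tt).
  apply: (cvgr_to_le cu); near=> y.
  by apply: uM'; near: y; [exact: nbhs_left_gt|exact: nbhs_left_lt].
- exact: uM'.
Unshelve. all: by end_near. Qed.

Theorem theorem3p2 (R : realType) (M K q0 : R) (psi : R -> R)
    (M_gt0 : 0 < M) (K_ge0 : 0 <= K) (K_le_q0 : K <= q0)
    (psi_C1 : C1_nonneg psi)
    (psi_ge1 : forall r : R, 0 <= r -> 1 <= psi r)
    (psi_int : ((2 * M)%:E <
       \int[@lebesgue_measure R]_(rho in `[q0, +oo[) (rho / psi rho)%:E)%E) :
  exists M1 : R,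
    forall (T ell : R) (a b f g f1 g1 : R -> R -> R -> R -> R) (u0 : R -> R),
    0 < T -> 0 < ell ->
    continuous_4 T ell a -> continuous_4 T ell f ->
    continuous_at_x T ell b -> continuous_at_x T (- ell) b ->
    continuous_at_x T ell g -> continuous_at_x T (- ell) g ->
    (forall t x z p : R, 0 <= t <= T -> - ell <= x <= ell -> 0 < a t x z p) ->
    (forall t z p : R, 0 <= t <= T ->
       0 < b t ell z p /\ 0 < b t (- ell) z p) ->
    (forall x y : R, - ell <= x <= ell -> - ell <= y <= ell ->
       `|u0 x - u0 y| <= K * `|x - y|) ->
    (forall t x z p : R, 0 <= t <= T -> - ell <= x <= ell -> - M <= z <= M ->
       `|f t x z p| <= a t x z p * psi `|p|) ->
    (forall t z p : R, 0 < t <= T -> - M <= z <= M -> q0 <= p ->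
       [/\ g t ell z p <= b t ell z p * p,
           - g t ell z (- p) <= b t ell z (- p) * p,
           - g t (- ell) z p <= b t (- ell) z p * p &
           g t (- ell) z (- p) <= b t (- ell) z (- p) * p]) ->
    (* (i): for the sign + the roles of x and y are exchanged with respect to
       the printed condition, with which the theorem is false *)
    (forall t x y z1 z2 p : R, 0 <= t <= T ->
       - ell <= x -> x <= y -> y <= ell ->
       - M <= z1 -> z1 <= z2 -> z2 <= M -> 0 <= p ->
       0 <= f1 t x z1 p - f1 t y z2 p /\
       0 <= f1 t y z1 (- p) - f1 t x z2 (- p)) ->
    (* (ii): g1 is taken at x = ell for the sign + and at x = - ell for the
       sign -; with x = ell for both signs, as printed, the theorem is false *)
    (forall t x z1 z2 p1 p2 : R, 0 <= t <= T -> - ell <= x <= ell ->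
       - M <= z1 -> z1 <= z2 -> z2 <= M -> q0 <= p1 -> p1 <= p2 ->
       0 <= f1 t x z1 p1 - g1 t ell z2 p2 /\
       0 <= f1 t x z1 (- p1) - g1 t (- ell) z2 (- p2)) ->
    (* (iii) *)
    (forall t x z1 z2 p1 p2 : R, 0 <= t <= T -> - ell <= x <= ell ->
       - M <= z1 -> z1 <= z2 -> z2 <= M -> q0 <= p2 -> p2 <= p1 ->
       0 <= g1 t ell z1 (- p1) - f1 t x z2 (- p2) /\
       0 <= g1 t (- ell) z1 p1 - f1 t x z2 p2) ->
    forall (tau : R) (u : R -> R -> R),
    0 < tau -> tau <= T ->
    classical_solution tau ell a b
      (fun t x z p => f t x z p + f1 t x z p)
      (fun t x z p => g t x z p + g1 t x z p) u ->
    (forall x : R, - ell <= x <= ell -> u 0 x = u0 x) ->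
    (supnorm (Omega tau ell) u <= M%:E)%E ->
    (supnorm (Omega tau ell) (Dx u) <= M1%:E)%E.
Proof.
have q0_ge0 : 0 <= q0 by exact: le_trans K_le_q0.
pose phi (r : R) := psi (Num.max 0 r).
have phiE r : 0 <= r -> phi r = psi r by move=> r0; rewrite /phi max_r.
have cphi : continuous phi by exact/continuous_comp_max/C1_nonneg_continuous.
have phi_gt0 r : 0 < phi r.
  by rewrite (lt_le_trans ltr01)// psi_ge1// le_max lexx.
have [q1 [q01 q1_int]] : exists b : R, q0 <= b /\
    ((2 * M)%:E < \int[@lebesgue_measure R]_(r in `[q0, b]) (r / phi r)%:E)%E.
  apply: integral_itv_cbnd_lt.
  - by move=> r qr; rewrite divr_ge0 ?(ltW (phi_gt0 _))// (le_trans q0_ge0).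
  - apply: continuous_subspaceT => r; apply: cvgM; first exact: cvg_id.
    by apply: cvgV; [rewrite gt_eqF|exact: cphi].
  - rewrite (lt_le_trans psi_int)// le_eqVlt; apply/orP; left; apply/eqP.
    apply: eq_integral => r; rewrite inE/= in_itv/= andbT => qr.
    by rewrite phiE// (le_trans q0_ge0).
(* Over a single point the integral is 0, which is not above [2 * M]. *)
have {}q01 : q0 < q1.
  rewrite lt_neqAle q01 andbT; apply/eqP => q01E; move: q1_int.
  by rewrite q01E set_itv1 integral_set1 lte_fin ltNge mulr_ge0// ltW.
have [s1 [h [Q [s1_gt0 h00 hs1 hQ]]]] := concave_barrier cphi phi_gt0 q01.
have {}hs1 : 2 * M < h s1 by rewrite -lte_fin hs1.
have dhQ s : 0 <= s <= s1 -> is_derive s 1 h (Q s) /\ is_derive s 1 Q (- phi (Q s)).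
  by move=> /hQ[].
have Qq s : 0 < s < s1 -> q0 <= Q s.
  by move=> /andP[s0 ss1]; have [|/andP[]] := hQ s; rewrite ?(ltW s0) ?(ltW ss1).
(* The lower bound dominates the initial data, because [K <= q0]; the upper one becomes the final
   estimate. *)
have h_bounds s : 0 <= s <= s1 -> q0 * s <= h s <= q1 * s.
  move=> /andP[s0 ss1].
  have [x /andP[x0 xs]|c /andP[c0 cs]] := is_derive_mean_value s0 (f := h) (df := Q).
    by have [] := hQ x; rewrite // x0 (le_trans xs ss1).
  rewrite h00 !subr0 => ->; have [|/andP[q0Q Qq1] _ _] := hQ c.
    by rewrite c0 (le_trans cs ss1).
  by rewrite !ler_wpM2r.
exists q1.
move=> T ell a b f g f1 g1 u0 T_gt0 ell_gt0 _ _ _ _ _ _ a_gt0 b_gt0 u0K f_le g_le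
  f1_mono f1g1 g1f1 tau u tau_gt0 tauT [ru int_eq right_eq left_eq] u_init u_le.
have ell2 : - ell < ell by lra.
have uM := classical_regularity_bound ru ell2 ((supnorm_le _ _ _).1 u_le).
have uMM t x : 0 < t < tau -> - ell <= x <= ell -> - M <= u t x <= M.
  by move=> tt xx; rewrite -ler_norml uM.
have tT t : 0 < t < tau -> 0 <= t <= T.
  by move=> /andP[t0 tt]; rewrite (ltW t0) (le_trans (ltW tt)).
have tT' t : 0 < t < tau -> 0 < t <= T.
  by move=> /andP[t0 tt]; rewrite t0 (le_trans (ltW tt)).
have barrier e : e = 1 \/ e = - 1 -> forall t x y, 0 < t < tau -> - ell <= y ->
    x <= ell -> 0 <= x - y <= s1 -> e * (u t x - u t y) <= h (x - y).
  move=> e1 t x y tt yl xl xy.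
  have ee : e * e = 1 by case: e1 => ->; rewrite ?mulr1 ?mulrNN ?mulr1.
  have eK (r p : R) : e * r = p -> r = e * p by move=> <-; rewrite mulrA ee mul1r.
  have en : `|e| = 1 by case: e1 => ->; rewrite ?normrN normr1.
  have e_norm r : e * r <= `|r| by rewrite (le_trans (ler_norm _))// normrM en mul1r.
  have e_norm' r : - `|r| <= e * r by rewrite lerNl -mulrN -[`|r|]normrN.
  (* The comparison function keeps only [f1], evaluated along [u] with the common slope [e * p];
     [a], [f], [b] and [g] are absorbed in the one-point inequalities. *)
  apply: (@doubled_barrier _ tau ell s1 e u h Q phi
    (fun t x p => e * f1 t x (u t x) (e * p))) => //.
  - by move=> s s01; have /andP[+ _] := h_bounds _ s01; apply: le_trans; rewrite mulr_ge0//; case/andP: s01.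
  - move=> {tt yl xl xy}x {}y yl xl xy.
    have /andP[+ _] := h_bounds _ xy; apply: le_trans.
    have xl' : - ell <= x <= ell by lra.
    have yl' : - ell <= y <= ell by lra.
    rewrite (le_trans (e_norm _))// !u_init// (le_trans (u0K _ _ xl' yl'))//.
    have xy0 : 0 <= x - y by case/andP: xy.
    by rewrite ger0_norm// ler_wpM2r.
  - move=> {tt yl xl xy}t {}x {}y tt yl xl xy.
    rewrite (le_trans (e_norm _))// (le_trans _ (ltW hs1))//.
    have /andP[? ?] : - M <= u t x <= M by apply: uMM => //; lra.
    have /andP[? ?] : - M <= u t y <= M by apply: uMM => //; lra.
    by rewrite ler_norml; lra.
  (* Concavity of the barrier contributes at most [- A * phi (Q s)], which outweighs [e * f] because
     [|f| <= a * psi]. *)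
  - move=> {tt yl xl xy}t {}x s tt xl /Qq q0p /eK dx dxx.
    have xl' : - ell <= x <= ell by lra.
    have := int_eq t x; rewrite /Omega /= !in_itv/= => /(_ (conj tt xl)).
    have := f_le t x (u t x) (e * Q s) (tT _ tt) xl' (uMM _ _ tt xl').
    have := a_gt0 t x (u t x) (e * Q s) (tT _ tt) xl'.
    rewrite dx normrM en mul1r ger0_norm ?(le_trans q0_ge0)// -(phiE (Q s)) ?(le_trans q0_ge0)//=.
    set A := a _ _ _ _; set ff := f _ _ _ _; set ff1 := f1 _ _ _ _ => A0 fA E.
    have -> : e * Dt u t x = A * (e * Dxx u t x) + e * ff + e * ff1.
      by rewrite (_ : Dt u t x = A * Dxx u t x + ff + ff1); [ring|lra].
    have : A * (e * Dxx u t x) <= A * - phi (Q s) by rewrite ler_pM2l.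
    by have := e_norm ff; lra.
  (* (ii) and (iii) with [x = +- ell] bound the boundary term [g1] by the value
     of [f1] at the same endpoint, so that (i) alone compares the two points. *)
  - move=> {tt yl xl xy}t s tt /Qq q0p dl.
    have := right_eq t tt.
    move=> /=; set z := u t ell; set r := lderive (u t) ell in dl *.
    have rE : r = e * (e * r) by rewrite mulrA ee mul1r.
    set p := e * r in dl rE.
    have lell : - ell <= ell <= ell by lra.
    have zM : - M <= z <= M by exact: uMM.
    (* Here [p = e * u_x] is at least [q0]. For [e = 1] the pair [G1], [F1] is used, for [e = - 1]
       the pair [G2], [F2]. *)
    have [G1 G2 _ _] := g_le t z p (tT' _ tt) zM (le_trans q0p dl).
    have [zM1 zM2] := andP zM.
    have [F1 _] := f1g1 t ell z z (Q s) p (tT _ tt) lell zM1 (lexx _) zM2 q0p dl.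
    have [F2 _] := g1f1 t ell z z p (Q s) (tT _ tt) lell zM1 (lexx _) zM2 q0p dl.
    move=> E; move: G1 G2 F1 F2 E; rewrite rE.
    by case: e1 => ->; rewrite ?mulN1r ?mul1r; lra.
  - move=> {tt yl xl xy}t {}x s tt xl /Qq q0p /eK dx dxx.
    have xl' : - ell <= x <= ell by lra.
    have := int_eq t x; rewrite /Omega /= !in_itv/= => /(_ (conj tt xl)).
    have := f_le t x (u t x) (e * Q s) (tT _ tt) xl' (uMM _ _ tt xl').
    have := a_gt0 t x (u t x) (e * Q s) (tT _ tt) xl'.
    rewrite dx normrM en mul1r ger0_norm ?(le_trans q0_ge0)// -(phiE (Q s)) ?(le_trans q0_ge0)//=.
    set A := a _ _ _ _; set ff := f _ _ _ _; set ff1 := f1 _ _ _ _ => A0 fA E.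
    have -> : e * Dt u t x = A * (e * Dxx u t x) + e * ff + e * ff1.
      by rewrite (_ : Dt u t x = A * Dxx u t x + ff + ff1); [ring|lra].
    have : A * phi (Q s) <= A * (e * Dxx u t x) by rewrite ler_pM2l.
    by have := e_norm' ff; lra.
  - move=> {tt yl xl xy}t s tt /Qq q0p dl.
    have := left_eq t tt.
    move=> /=; set z := u t (- ell); set r := rderive (u t) (- ell) in dl *.
    have rE : r = e * (e * r) by rewrite mulrA ee mul1r.
    set p := e * r in dl rE.
    have lell : - ell <= - ell <= ell by lra.
    have zM : - M <= z <= M by exact: uMM.
    have [_ _ G1 G2] := g_le t z p (tT' _ tt) zM (le_trans q0p dl).
    have [zM1 zM2] := andP zM.
    have [_ F1] := f1g1 t (- ell) z z (Q s) p (tT _ tt) lell zM1 (lexx _) zM2 q0p dl.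
    have [_ F2] := g1f1 t (- ell) z z p (Q s) (tT _ tt) lell zM1 (lexx _) zM2 q0p dl.
    move=> E; move: G1 G2 F1 F2 E; rewrite rE.
    by case: e1 => ->; rewrite ?mulN1r ?mul1r; lra.
  - move=> {tt yl xl xy}t {}x {}y s tt yl yx xl /Qq q0p.
    have /andP[zx1 zx2] : - M <= u t x <= M by apply: uMM => //; lra.
    have /andP[zy1 zy2] : - M <= u t y <= M by apply: uMM => //; lra.
    have p0 : 0 <= Q s by exact: le_trans q0p.
    (* The sign [e] selects the sign in (i). For [e = - 1] the order of the two values of [u] is
       reversed, which is the order that the sign - needs. *)
    case: e1 => ->; rewrite ?mulN1r ?mul1r => uyx.
      have [+ _] := f1_mono t y x (u t y) (u t x) (Q s) (tT _ tt) yl (ltW yx) xl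
        zy1 (ltW uyx) zx2 p0.
      by rewrite subr_ge0.
    rewrite ltrN2 in uyx.
    have [_] := f1_mono t y x (u t x) (u t y) (Q s) (tT _ tt) yl (ltW yx) xl
      zx1 (ltW uyx) zy2 p0.
    by rewrite subr_ge0 lerN2.
apply/supnorm_le => t x; rewrite /Omega /= !in_itv/= => -[tt xl].
have du : is_derive x 1 (u t) (Dx u t x).
  by apply: derivable_is_derive1; apply: (cr_dx ru); rewrite /Omega /= !in_itv/=.
(* The barriers for both signs bound the difference quotient in absolute value by [q1], and its
   limit is [u_x]. *)
have slope : \forall z \near x^'+, `|(u t z - u t x) / (z - x)| <= q1.
  near=> z.
  have xz : x < z by near: z; exact: nbhs_right_gt.
  have zell : z <= ell by near: z; apply: nbhs_right_le; lra.
  have zs : 0 <= z - x <= s1.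
    rewrite subr_ge0 ltW// lerBlDl.
    by near: z; apply: nbhs_right_le; rewrite ltrDl.
  have xl' : - ell <= x by lra.
  have /andP[_ hq] := h_bounds _ zs.
  have b1 := le_trans (barrier 1 (or_introl erefl) t z x tt xl' zell zs) hq.
  have b2 := le_trans (barrier (- 1) (or_intror erefl) t z x tt xl' zell zs) hq.
  rewrite normrM normfV (gtr0_norm (x := z - x)) ?subr_gt0// ler_pdivrMr ?subr_gt0//.
  by rewrite ler_norml; move: b1 b2; lra.
by apply: cvgr_to_le slope; apply: cvg_norm; exact: is_derive_right_quotient.
Unshelve. all: by end_near. Qed.
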